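(* Let $k,b,n,c,m\in\mathbb{N}^*$ be such that $k,bn,cm\geq 2$ and assume $n\wedge m=1$. Write $m=qn+r$ with $q\geq 0$ and $0\leq r\leq n-1$. Then $W_b^c(k,bn,cm)$ admits the following presentation. Generators: $x_1,\dots,x_n,y,z$. Relations: \begin{align*} & x_i^k=y^b=z^c=1 && (1\leq i\leq n),\\ & x_1\cdots x_n y z=z x_1\cdots x_n y,\\ & x_{i+1}\cdots x_n y z\,\delta^{q-1}x_1\cdots x_{i+r}=x_i\cdots x_n y z\,\delta^{q-1}x_1\cdots x_{i+r-1} && (1\leq i\leq n-r),\\ & x_{i+1}\cdots x_n y z\,\delta^{q}x_1\cdots x_{i+r-n}=x_i\cdots x_n y z\,\delta^{q}x_1\cdots x_{i+r-n-1} && (n-r+1\leq i\leq n), \end{align*} where $\delta$ denotes $x_1\cdots x_n y$. In terms of the canonical generators $s,t,u$ of $J(k,bn,cm)$, we have $x_i=t^{i-1}st^{1-i}$ for all $1\leq i\leq n$, $y=t^n$ and $z=u^m$.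
   Context: $\mathbb{N}^*$ is the set of positive integers and $n\wedge m$ denotes the gcd of $n$ and $m$. For integers $k,n,m\geq 2$, $J(k,n,m)$ is the group with presentation $\langle s,t,u\mid s^k=t^n=u^m=1,\ stu=tus=ust\rangle$; $s,t,u$ are its canonical generators. For $k,b,n,c,m\in\mathbb{N}^*$ with $k,bn,cm\geq 2$ and $n\wedge m=1$, $W_b^c(k,bn,cm)$ denotes the normal closure of $\{s,t^n,u^m\}$ in $J(k,bn,cm)$, where $s,t,u$ are the canonical generators of $J(k,bn,cm)$. Conventions: $x_{i+1}\cdots x_n$ is the empty word when $i=n$, and $x_1\cdots x_j$ is the empty word when $j=0$. The exponent $q-1$ may equal $-1$. Since $n\wedge m=1$, $r=0$ occurs only for $n=1$. *)

(* Defs.v *)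
From HB Require Import structures.
From mathcomp Require Import all_boot all_algebra.
From mathcomp Require Import boolp classical_sets.

Set Implicit Arguments.
Unset Strict Implicit.
Unset Printing Implicit Defensive.

Local Open Scope classical_set_scope.
Local Open Scope quotient_scope.
Local Open Scope group_scope.

Section NormalClosure.
Variable G : groupType.

Definition normal_subgroup (H : set G) : Prop :=
  [/\ H 1, forall x y, H x -> H y -> H (x * y), forall x, H x -> H x^-1
    & forall x y, H x -> H (x ^ y)].

Definition normal_closure (A : set G) : set G := smallest normal_subgroup A.

Lemma normal_closureP A : normal_subgroup (normal_closure A).
Proof.
split=> [H [[]]//|x y Ax Ay H|x Ax H|x y Ax H] HA; have [[H1 HM HV HJ] _] := HA.
- by apply: HM; [apply: Ax | apply: Ay].
- by apply: HV; apply: Ax.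
- by apply: HJ; apply: Ax.
Qed.

End NormalClosure.

Definition ncl_group (G : groupType) (A : set G) : Type :=
  {x : G | x \in normal_closure A}.

Section NclGroup.
Variables (G : groupType) (A : set G).

HB.instance Definition _ := SubChoice.on (ncl_group A).

Lemma ncl_group_closed : group_closed [in normal_closure A].
Proof.
have [N1 NM NV _] := normal_closureP A.
split=> [|x y]; rewrite !inE // => Nx Ny.
exact: NM Nx (NV _ Ny).
Qed.

HB.instance Definition _ :=
  SubChoice_isSubGroup.Build G _ (ncl_group A) ncl_group_closed.

End NclGroup.

Section QuotientByNormalClosure.
Variables (G : groupType) (A : set G).

Definition ncl_eq (x y : G) : bool := x^-1 * y \in normal_closure A.

Lemma ncl_eq_equiv : equiv_class_of ncl_eq.
Proof.
have [N1 NM NV NJ] := normal_closureP A.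
split=> [x|x y|y x z]; rewrite /ncl_eq.
- by rewrite mulVg inE.
- by apply/idP/idP; rewrite !inE => /NV; rewrite invgM invgK.
- by rewrite !inE => xy yz; have := NM _ _ xy yz; rewrite mulgA mulgK.
Qed.

Canonical ncl_equiv : equiv_rel G := EquivRelPack ncl_eq_equiv.

Definition ncl_quotient : Type := {eq_quot ncl_equiv}.

HB.instance Definition _ := Choice.on ncl_quotient.
HB.instance Definition _ := EqQuotient.on ncl_quotient.

Local Notation cls x := (\pi_ncl_quotient (x : G)).

Definition quo1 : ncl_quotient := cls 1.
Definition quoV (a : ncl_quotient) : ncl_quotient := cls ((repr a)^-1).
Definition quoM (a b : ncl_quotient) : ncl_quotient := cls (repr a * repr b).

Lemma quoVE x : quoV (cls x) = cls (x^-1).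
Proof.
have [N1 NM NV NJ] := normal_closureP A.
apply/eqmodP; rewrite /= /ncl_eq invgK.
have : repr (cls x) == x %[mod ncl_quotient] by rewrite reprK.
rewrite eqmodE /= /ncl_eq !inE => /NV/(NJ _ (x^-1)).
by rewrite invgM invgK conjgE invgK !mulgA mulgV mul1g.
Qed.

Lemma quoME x y : quoM (cls x) (cls y) = cls (x * y).
Proof.
have [N1 NM NV NJ] := normal_closureP A.
apply/eqmodP; rewrite /= /ncl_eq.
have : repr (cls x) == x %[mod ncl_quotient] by rewrite reprK.
have : repr (cls y) == y %[mod ncl_quotient] by rewrite reprK.
set y' := repr (cls y); set x' := repr (cls x).
rewrite !eqmodE /= /ncl_eq !inE => Ny /(NJ _ y') Nx.
by have := NM _ _ Nx Ny; rewrite conjgE invgM !mulgA mulgK.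
Qed.

Lemma quoMA : associative quoM.
Proof.
elim/quotW=> x; elim/quotW=> y; elim/quotW=> z.
by rewrite (quoME y z) (quoME x (y * z)) (quoME x y) (quoME (x * y) z) mulgA.
Qed.

Lemma quo1M : left_id quo1 quoM.
Proof. by elim/quotW=> x; rewrite (quoME 1 x) mul1g. Qed.

Lemma quoM1 : right_id quo1 quoM.
Proof. by elim/quotW=> x; rewrite (quoME x 1) mulg1. Qed.

Lemma quoVM : left_inverse quo1 quoV quoM.
Proof. by elim/quotW=> x; rewrite (quoVE x) (quoME x^-1 x) mulVg. Qed.

Lemma quoMV : right_inverse quo1 quoV quoM.
Proof. by elim/quotW=> x; rewrite (quoVE x) (quoME x x^-1) mulgV. Qed.

HB.instance Definition _ :=
  isGroup.Build ncl_quotient quoMA quo1M quoM1 quoVM quoMV.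

End QuotientByNormalClosure.

Section FreeGroup.
Variable X : choiceType.

(* The letter [(x, false)] stands for [x], and [(x, true)] for its inverse. *)
Definition word : Type := seq (X * bool).

HB.instance Definition _ := Choice.on word.

Inductive free_eq : word -> word -> Prop :=
| free_refl u : free_eq u u
| free_sym u v : free_eq u v -> free_eq v u
| free_trans u v w : free_eq u v -> free_eq v w -> free_eq u w
| free_cancel u v x e : free_eq (u ++ (x, e) :: (x, ~~ e) :: v) (u ++ v).

Definition free_eqb (u v : word) : bool := `[< free_eq u v >].

Lemma free_eq_equiv : equiv_class_of free_eqb.
Proof.
split=> [u|u v|v u w].
- by apply/asboolP/free_refl.
- by apply/asboolP/asboolP; apply: free_sym.
- by move=> /asboolP uv /asboolP vw; apply/asboolP/(free_trans uv).
Qed.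

Canonical free_equiv : equiv_rel word := EquivRelPack free_eq_equiv.

Definition freegroup : Type := {eq_quot free_equiv}.

HB.instance Definition _ := Choice.on freegroup.
HB.instance Definition _ := EqQuotient.on freegroup.

Definition word_inv (u : word) : word := rev [seq (l.1, ~~ l.2) | l <- u].

Definition free1 : freegroup := \pi_freegroup [::].
Definition freeV (a : freegroup) : freegroup := \pi_freegroup (word_inv (repr a)).
Definition freeM (a b : freegroup) : freegroup := \pi_freegroup (repr a ++ repr b).

Lemma free_eq_repr u : free_eq (repr (\pi_freegroup u)) u.
Proof.
by apply/asboolP; rewrite -[asbool _]/(free_equiv _ _) -eqmodE reprK.
Qed.

Lemma free_eq_cat a b u v :
  free_eq u v -> free_eq (a ++ u ++ b) (a ++ v ++ b).
Proof.
elim=> [w|w w' _|w w' w'' _ + _|w w' x e]; first exact: free_refl.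
- exact: free_sym.
- exact: free_trans.
- by have := free_cancel (a ++ w) (w' ++ b) x e; rewrite -!catA /=.
Qed.

Lemma free_eq_inv u v : free_eq u v -> free_eq (word_inv u) (word_inv v).
Proof.
elim=> [w|w w' _|w w' w'' _ + _|w w' x e]; first exact: free_refl.
- exact: free_sym.
- exact: free_trans.
- rewrite /word_inv !map_cat /= !rev_cat !rev_cons -!cats1 -!catA negbK.
  exact: free_cancel.
Qed.

Lemma freeVE u : freeV (\pi_freegroup u) = \pi_freegroup (word_inv u).
Proof. by apply/eqmodP/asboolP/free_eq_inv/free_eq_repr. Qed.

Lemma freeME u v : freeM (\pi_freegroup u) (\pi_freegroup v) = \pi_freegroup (u ++ v).
Proof.
apply/eqmodP/asboolP.
apply: (free_trans (v := u ++ repr (\pi_freegroup v))).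
- exact: (free_eq_cat [::] _ (free_eq_repr u)).
- by have := free_eq_cat u [::] (free_eq_repr v); rewrite !cats0.
Qed.

Lemma freeMA : associative freeM.
Proof.
elim/quotW=> u; elim/quotW=> v; elim/quotW=> w.
by rewrite (freeME v w) (freeME u (v ++ w)) (freeME u v) (freeME (u ++ v) w)
           catA.
Qed.

Lemma free1M : left_id free1 freeM.
Proof. by elim/quotW=> u; rewrite (freeME [::] u). Qed.

Lemma freeM1 : right_id free1 freeM.
Proof. by elim/quotW=> u; rewrite (freeME u [::]) cats0. Qed.

Lemma free_eq_catV u : free_eq (u ++ word_inv u) [::].
Proof.
elim: u => [|[x e] u IHu]; first exact: free_refl.
rewrite /word_inv /= rev_cons -cats1 catA.
have := free_eq_cat [:: (x, e)] [:: (x, ~~ e)] IHu.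
by move/free_trans; apply; apply: (free_cancel [::] [::]).
Qed.

Lemma word_invK : involutive word_inv.
Proof.
move=> u; rewrite /word_inv map_rev revK -map_comp -[RHS]map_id.
by apply: eq_map => -[x e] /=; rewrite negbK.
Qed.

Lemma freeMV : right_inverse free1 freeV freeM.
Proof.
elim/quotW=> u; rewrite (freeVE u) (freeME u (word_inv u)).
exact/eqmodP/asboolP/free_eq_catV.
Qed.

Lemma freeVM : left_inverse free1 freeV freeM.
Proof.
elim/quotW=> u; rewrite (freeVE u) (freeME (word_inv u) u).
apply/eqmodP/asboolP.
by rewrite -{2}[u]word_invK; apply: free_eq_catV.
Qed.

HB.instance Definition _ :=
  isGroup.Build freegroup freeMA free1M freeM1 freeVM freeMV.

Definition free_gen (x : X) : freegroup := \pi_freegroup [:: (x, false)].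

End FreeGroup.

Section Presentation.
Variables (X : choiceType) (R : freegroup X -> freegroup X -> Prop).

(* A presentation is given by a set of generators [X] and a set of relations
   [u = v] between elements of the free group on [X], encoded by [R u v]. *)
Definition relators : set (freegroup X) :=
  [set w | exists u v, R u v /\ w = u * v^-1].

Definition presented : Type := ncl_quotient relators.

HB.instance Definition _ := Group.on presented.

Definition pres_gen (x : X) : presented := \pi_presented (free_gen x).

End Presentation.

Definition expgz (G : groupType) (x : G) (a : int) : G :=
  match a with Posz p => x ^+ p | Negz p => x ^- p.+1 end.

Inductive J_generator := Js | Jt | Ju.

Definition J_generator_ord (g : J_generator) : 'I_3 :=
  match g with Js => inord 0 | Jt => inord 1 | Ju => inord 2 end.
Definition J_generator_of_ord (i : 'I_3) : J_generator :=
  match val i with 0 => Js | 1 => Jt | _ => Ju end.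
Lemma J_generator_ordK : cancel J_generator_ord J_generator_of_ord.
Proof. by case; rewrite /J_generator_of_ord /= inordK. Qed.
HB.instance Definition _ := Choice.copy J_generator (can_type J_generator_ordK).

Section J.
Variables k n m : nat.

Let s := free_gen Js.
Let t := free_gen Jt.
Let u := free_gen Ju.

Inductive J_relation : freegroup J_generator -> freegroup J_generator -> Prop :=
| J_rel_s : J_relation (s ^+ k) 1
| J_rel_t : J_relation (t ^+ n) 1
| J_rel_u : J_relation (u ^+ m) 1
| J_rel_stu_tus : J_relation (s * t * u) (t * u * s)
| J_rel_tus_ust : J_relation (t * u * s) (u * s * t).

Definition J : Type := presented J_relation.
HB.instance Definition _ := Group.on J.

Definition J_s : J := pres_gen J_relation Js.
Definition J_t : J := pres_gen J_relation Jt.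
Definition J_u : J := pres_gen J_relation Ju.

End J.

Section W.
Variables k b n c m : nat.

Definition W : Type :=
  ncl_group [set J_s k (b * n) (c * m); J_t k (b * n) (c * m) ^+ n;
                 J_u k (b * n) (c * m) ^+ m].
HB.instance Definition _ := SubGroup.on W.

End W.

(* [Wx i] is the generator written x_(i+1): ordinals count from 0. *)
Inductive W_generator (n : nat) := Wx of 'I_n | Wy | Wz.
Arguments Wy {n}.
Arguments Wz {n}.

Definition W_generator_sum n (g : W_generator n) : 'I_n + bool :=
  match g with Wx i => inl i | Wy => inr true | Wz => inr false end.
Definition W_generator_of_sum n (g : 'I_n + bool) : W_generator n :=
  match g with inl i => Wx i | inr true => Wy | inr false => Wz end.
Lemma W_generator_sumK n : cancel (@W_generator_sum n) (@W_generator_of_sum n).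
Proof. by case. Qed.
HB.instance Definition _ n :=
  Choice.copy (W_generator n) (can_type (@W_generator_sumK n)).

Section WPresentation.
Variables k b n c q r : nat.

Let y : freegroup (W_generator n) := free_gen Wy.
Let z : freegroup (W_generator n) := free_gen Wz.

(* [W_word i j] is the word x_i x_(i+1) ... x_j, with indices counted from 1;
   it is empty when j < i. *)
Definition W_word (i j : nat) : freegroup (W_generator n) :=
  \prod_(l < n | i <= l.+1 <= j) free_gen (Wx l).

Let delta := W_word 1 n * y.

(* The last two families are indexed by i from 1 to n, so that the subtractions i + r - 1, i + r - n and
   i + r - n - 1 of natural numbers are never truncated. *)
Inductive W_relation :
  freegroup (W_generator n) -> freegroup (W_generator n) -> Prop :=
| W_rel_x (i : 'I_n) : W_relation (free_gen (Wx i) ^+ k) 1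
| W_rel_y : W_relation (y ^+ b) 1
| W_rel_z : W_relation (z ^+ c) 1
| W_rel_comm : W_relation (W_word 1 n * y * z) (z * W_word 1 n * y)
| W_rel_lo (i : nat) of 1 <= i <= n - r :
    W_relation
      (W_word i.+1 n * y * z * expgz delta (q%:Z - 1)%R * W_word 1 (i + r))
      (W_word i n * y * z * expgz delta (q%:Z - 1)%R * W_word 1 (i + r - 1))
| W_rel_hi (i : nat) of n - r + 1 <= i <= n :
    W_relation
      (W_word i.+1 n * y * z * delta ^+ q * W_word 1 (i + r - n))
      (W_word i n * y * z * delta ^+ q * W_word 1 (i + r - n - 1)).

End WPresentation.

(* Main.v *)
(* Write P for the presented group, extend x_1, ..., x_n to a sequence X_j (j >= 0,
   X_j = x_(j+1) for j < n) by X_(j+n) = y X_j y^-1, and put p_j = X_0 ... X_(j-1).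
   Modulo the commutation of z with delta = p_n y, the two long families of
   relations say that p_j^-1 z delta^q p_(j+r) does not depend on j. Its value
   C commutes with y and satisfies C X_(j+r) = X_j C. Hence
   tau : X_j |-> X_(j+1), y |-> y, z |-> x_1^-1 z x_1 is an endomorphism of P
   (conjugation by t in J), tau^n is conjugation by y, so that tau^(bn) = 1, and
   C tau^r(a) = a C for all a.
   In J the element D = stu is central, u = (st)^-1 D and D^m = C t^r, so J is
   recovered from P by adjoining t, which acts by tau, and a central D: in the
   semidirect product of P by Z/bn x Z, the elements y^-1 t^n and C t^r D^-m are
   central, and the subgroup they generate meets P trivially. So P embeds in the
   quotient by this subgroup, and the embedding factors through P -> J.
   Finally the image of P in J is normal: it is stable under conjugation by
   s, t and the central element D, hence by u. *)
From HB Require Import structures.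
Require Import Defs.
From mathcomp Require Import all_boot all_order all_algebra.
From mathcomp Require Import boolp classical_sets.
From mathcomp Require Import zify.

Set Implicit Arguments.
Unset Strict Implicit.
Unset Printing Implicit Defensive.

Local Open Scope group_scope.

(** * Universal properties of free groups, quotients and presented groups *)

Notation "{ 'groupmorph' G -> H }" := (UMagmaMorphism.type G H)
  (at level 0, G at level 98, H at level 99) : type_scope.

Lemma groupmorph_exists (G H : groupType) (f : G -> H) :
  {morph f : a b / a * b} -> exists g : {groupmorph G -> H}, g =1 f.
Proof.
move=> fM; have fF : {morph f : a b / a / b}.
  move=> a b; apply: (mulIg (f b)); rewrite -fM !mulgVK //.
pose fmix := isGroupMorphism.Build G H f fF.
pose g : {groupmorph G -> H} := HB.pack f fmix.
by exists g.
Qed.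

Lemma freegroup_lift (X : choiceType) (H : groupType) (phi : X -> H) :
  exists f : {groupmorph freegroup X -> H}, forall x, f (free_gen x) = phi x.
Proof.
pose ev (w : word X) := \prod_(l <- w) if l.2 then (phi l.1)^-1 else phi l.1.
(* Invariance under free cancellation lets [ev] be computed on any representative. *)
have ev_eq u v : free_eq u v -> ev u = ev v.
  elim=> // [u' v' w _ -> _ -> //|u' v' x e].
  rewrite /ev !big_cat !big_cons /=; congr (_ * _).
  by case: e => /=; rewrite ?mulKg ?mulVKg.
pose f (a : freegroup X) := ev (repr a).
have fE w : f (\pi_(freegroup X)%qT w) = ev w by apply/ev_eq/free_eq_repr.
have fM : {morph f : a b / a * b}.
  elim/quotW=> u; elim/quotW=> v.
  by rewrite [_ * _](freeME u v) !fE /ev big_cat.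
have [g gE] := groupmorph_exists fM.
by exists g => x; rewrite gE fE /ev big_seq1.
Qed.

Lemma freegroup_ind (X : choiceType) (S : freegroup X -> Prop) :
  S 1 -> (forall x a, S a -> S (free_gen x * a)) ->
  (forall x a, S a -> S ((free_gen x)^-1 * a)) -> forall a, S a.
Proof.
move=> S1 SM SV; elim/quotW; elim=> [|[x e] w IHw]; first exact: S1.
case: e; last by have := SM x _ IHw; rewrite [_ * _](freeME [:: _] w).
have := SV x _ IHw; rewrite [_^-1](freeVE [:: (x, false)]).
by rewrite [_ * _](freeME [:: _] w).
Qed.

(** A named copy of the quotient map, to which a morphism structure can be attached. *)
Definition ncl_proj (G : groupType) (A : set G) (x : G) : ncl_quotient A :=
  \pi_(ncl_quotient A)%qT x.

Lemma ncl_projM (G : groupType) (A : set G) : {morph ncl_proj A : x y / x * y}.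
Proof. by move=> x y; rewrite [RHS]quoME. Qed.

Lemma ncl_proj1 (G : groupType) (A : set G) : ncl_proj A 1 = 1.
Proof. by []. Qed.

HB.instance Definition _ (G : groupType) (A : set G) :=
  isUMagmaMorphism.Build G (ncl_quotient A) (ncl_proj A)
    (ncl_proj1 A, @ncl_projM G A).

Lemma ncl_proj_eq1 (G : groupType) (A : set G) x :
  ncl_proj A x = 1 <-> normal_closure A x.
Proof.
have [_ _ NV _] := normal_closureP A.
have -> : (ncl_proj A x = 1) <-> normal_closure A x^-1.
  rewrite -[1](ncl_proj1 A) /ncl_proj.
  split=> [/eqP|Nx].
    by rewrite eqmodE /= /ncl_eq mulg1 inE.
  by apply/eqP; rewrite eqmodE /= /ncl_eq mulg1 inE.
by split=> /NV; rewrite ?invgK.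
Qed.

Lemma ncl_proj_rel (G : groupType) (A : set G) x : A x -> ncl_proj A x = 1.
Proof. by move=> Ax; apply/ncl_proj_eq1 => N [_]; apply. Qed.

Lemma ncl_quotient_lift (G H : groupType) (A : set G) (h : {groupmorph G -> H}) :
  (forall x, A x -> h x = 1) ->
  exists f : {groupmorph ncl_quotient A -> H}, forall x, f (ncl_proj A x) = h x.
Proof.
move=> hA.
(* The kernel of [h] is a normal subgroup containing [A], hence contains its normal closure. *)
have hN x : normal_closure A x -> h x = 1.
  move=> /(_ [set u | h u = 1]%classic); apply; split=> //.
  split; rewrite /= ?gmulf1 //= => u.
  - by move=> v hu hv; rewrite gmulfM hu hv mulg1.
  - by move=> hu; rewrite gmulfV hu invg1.
  - by move=> v hu; rewrite gmulfJ hu conj1g.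
pose f (a : ncl_quotient A) := h (repr a).
have fE x : f (ncl_proj A x) = h x.
  apply/eqP; rewrite /f -divg_eq1 -gmulfF; apply/eqP/hN/ncl_proj_eq1.
  by rewrite gmulfF /= {1}/ncl_proj reprK divgg.
have fM : {morph f : a b / a * b}.
  by elim/quotW=> u; elim/quotW=> v; rewrite -ncl_projM !fE gmulfM.
have [g gE] := groupmorph_exists fM.
by exists g => x; rewrite gE fE.
Qed.

Section Presented.
Variables (X : choiceType) (R : freegroup X -> freegroup X -> Prop).

Lemma presented_proj :
  exists g : {groupmorph freegroup X -> presented R},
    (forall x, g (free_gen x) = pres_gen R x) /\ (forall u v, R u v -> g u = g v).
Proof.
exists (ncl_proj (relators R) : {groupmorph _ -> presented R}); split=> // u v Ruv.
by apply/divg1_eq; rewrite -gmulfF; apply: ncl_proj_rel; exists u, v.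
Qed.

Lemma presented_lift (H : groupType) (phi : X -> H) :
  (forall g : {groupmorph freegroup X -> H},
    (forall x, g (free_gen x) = phi x) -> forall u v, R u v -> g u = g v) ->
  exists f : {groupmorph presented R -> H}, forall x, f (pres_gen R x) = phi x.
Proof.
move=> relphi; have [g gE] := freegroup_lift phi.
have [_ [u [v [/(relphi g gE) guv ->]]]|f fE] := @ncl_quotient_lift _ _ (relators R) g.
  by rewrite gmulfF guv divgg.
by exists f => x; rewrite [LHS]fE.
Qed.

Lemma presented_ind (S : presented R -> Prop) :
  S 1 -> (forall x a, S a -> S (pres_gen R x * a)) ->
  (forall x a, S a -> S ((pres_gen R x)^-1 * a)) -> forall a, S a.
Proof.
move=> S1 SM SV; elim/quotW; elim/freegroup_ind => [|x a Sa|x a Sa].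
- exact: S1.
- by have := SM x _ Sa; rewrite [_ * _]quoME.
- by have := SV x _ Sa; rewrite [_^-1]quoVE [_ * _]quoME.
Qed.

Lemma presented_ext (H : groupType) (f g : presented R -> H) :
  {morph f : a b / a * b} -> {morph g : a b / a * b} ->
  (forall x, f (pres_gen R x) = g (pres_gen R x)) -> f =1 g.
Proof.
move=> /groupmorph_exists[f' f'E] /groupmorph_exists[g' g'E] fg a.
rewrite -f'E -g'E; elim/presented_ind: a => [|x a IHa|x a IHa].
- by rewrite !gmulf1.
- by rewrite !gmulfM /= f'E g'E fg IHa.
- by rewrite !gmulfM !gmulfV /= f'E g'E fg IHa.
Qed.

End Presented.

(** * Families satisfying the relations, indexed by all natural numbers *)

Section WFamily.
Variables (H : groupType) (k b n c q r : nat) (X : nat -> H) (y z : H).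

Definition prefix_prod j := \prod_(l < j) X l.

Definition W_delta := prefix_prod n * y.

Definition W_twist j := (prefix_prod j)^-1 * z * W_delta ^+ q * prefix_prod (j + r).

(* [X j] stands for x_(j+1): the generators are extended to all indices,
   periodically up to conjugation by [y], so that the last two families of relations
   become the single statement that [W_twist] is constant. *)
Record W_family : Prop := WFamily {
  W_family_period : forall j, X (j + n) = y * X j * y^-1;
  W_family_x : forall j, X j ^+ k = 1;
  W_family_y : y ^+ b = 1;
  W_family_z : z ^+ c = 1;
  W_family_comm : commute z W_delta;
  W_family_twist : forall j, W_twist j = W_twist 0 }.

Lemma prefix_prod0 : prefix_prod 0 = 1.
Proof. exact: big_ord0. Qed.

Lemma prefix_prodS j : prefix_prod j.+1 = prefix_prod j * X j.
Proof. exact: big_ord_recr. Qed.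

Lemma prefix_prodSl j : prefix_prod j.+1 = X 0 * \prod_(l < j) X l.+1.
Proof. exact: big_ord_recl. Qed.

Hypothesis period : forall j, X (j + n) = y * X j * y^-1.

Lemma prefix_prod_period j : prefix_prod (j + n) = W_delta * prefix_prod j * y^-1.
Proof.
elim: j => [|j IHj]; first by rewrite prefix_prod0 mulg1 mulgK.
by rewrite addSn !prefix_prodS IHj period !mulgA mulgVK.
Qed.

Hypothesis comm : commute z W_delta.

Lemma commute_z_deltaX j : commute z (W_delta ^+ j).
Proof. exact: commuteX. Qed.

(** Conjugation by delta fixes z delta^q, so replacing p_j by p_(j+n) = delta p_j y^-1 leaves only a
    conjugation by [y]. *)
Lemma W_twist_period j : W_twist (j + n) = y * W_twist j * y^-1.
Proof.
have shift : W_delta^-1 * (z * W_delta ^+ q * W_delta) = z * W_delta ^+ q.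
  by rewrite -(mulgA z) -expgSr (commute_z_deltaX q.+1) expgS -(mulgA W_delta) mulKg
    commute_z_deltaX.
rewrite /W_twist addnAC !prefix_prod_period; move: W_delta shift => d shift.
by rewrite !invgM invgK -[in RHS](mulgA _ z) -[in RHS]shift !mulgA.
Qed.

Hypothesis twist_lt : forall j, j < n -> W_twist j.+1 = W_twist j.

(** By [W_twist_period], the equality at [j >= n] is a conjugate of the one at [j - n], so [n]
    consecutive equalities suffice. *)
Lemma W_twist_const : 0 < n -> forall j, W_twist j = W_twist 0.
Proof.
move=> n_gt0.
have step : forall j, W_twist j.+1 = W_twist j.
  elim/ltn_ind=> j IHj; have [/twist_lt //|le_nj] := ltnP j n.
  rewrite -(subnK le_nj) -addSn !W_twist_period IHj // -{2}(subnK le_nj).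
  by rewrite -[leqLHS]addn0 ltn_add2l.
by elim=> // j <-.
Qed.

End WFamily.

Section WFamilyTheory.
Variables (H : groupType) (k b n c q r : nat) (X : nat -> H) (y z : H).
Hypothesis n_gt0 : 0 < n.

Lemma W_family_finite :
  (forall j, X (j + n) = y * X j * y^-1) ->
  (forall j, j < n -> X j ^+ k = 1) -> y ^+ b = 1 -> z ^+ c = 1 ->
  commute z (W_delta n X y) ->
  (forall j, j < n -> W_twist n q r X y z j.+1 = W_twist n q r X y z j) ->
  W_family k b n c q r X y z.
Proof.
move=> per Xk yb zc comm twist; split=> //; last exact: W_twist_const.
elim/ltn_ind=> j IHj; have [/Xk //|le_nj] := ltnP j n.
have {}IHj : X (j - n) ^+ k = 1 by apply: IHj; rewrite ltn_subrL n_gt0 (leq_trans n_gt0).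
rewrite -(subnK le_nj) per.
have -> : y * X (j - n) * y^-1 = X (j - n) ^ y^-1 by rewrite conjgE invgK mulgA.
by rewrite -conjXg IHj conj1g.
Qed.

Hypothesis fam : W_family k b n c q r X y z.
Let per := W_family_period fam.
Let comm := W_family_comm fam.

(** Shifting the index by [n] conjugates the twist by [y], yet the twist is constant. *)
Lemma W_family_commute_y : commute y (W_twist n q r X y z 0).
Proof.
have := W_twist_period q r per comm 0; rewrite (W_family_twist fam) => e.
by rewrite /commute [in RHS]e mulgVK.
Qed.

(** Passing from the twist at [j] to the one at [j.+1] inserts [(X j)^-1] on the left and
    [X (j + r)] on the right. *)
Lemma W_family_twist_comm j :
  W_twist n q r X y z 0 * X (j + r) = X j * W_twist n q r X y z 0.
Proof.
rewrite -{2}(W_family_twist fam j.+1) -{1}(W_family_twist fam j) /W_twist.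
by rewrite addSn !prefix_prodS invgM !mulgA mulgV mul1g.
Qed.

End WFamilyTheory.

(** * The relations of the presentation as constancy of the twist *)

Section WRelation.
Variables (H : groupType) (n q : nat) (X : nat -> H) (y z : H).
Variable g : {groupmorph freegroup (W_generator n) -> H}.
Hypotheses (gx : forall i : 'I_n, g (free_gen (Wx i)) = X i)
  (gy : g (free_gen Wy) = y) (gz : g (free_gen Wz) = z).

(** [W_word] counts letters from 1 and [X] from 0, whence the shift of the left index. *)
Lemma gmulf_W_word i j : i <= j <= n ->
  g (W_word n i.+1 j) = (prefix_prod X i)^-1 * prefix_prod X j.
Proof.
move=> /andP[le_ij le_jn]; rewrite gmulf_prod.
under eq_bigr do rewrite gx.
rewrite /prefix_prod -!(big_mkord xpredT X) (big_cat_nat (n := i) (p := j)) //= mulKg.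
rewrite (big_nat_widen _ _ _ _ _ le_jn) big_geq_mkord.
by apply: eq_bigl => l; rewrite /= andbC.
Qed.

Lemma gmulf_W_word1 j : j <= n -> g (W_word n 1 j) = prefix_prod X j.
Proof. by move=> le_jn; rewrite gmulf_W_word // prefix_prod0 invg1 mul1g. Qed.

Lemma W_rel_comm_iff :
  g (W_word n 1 n * free_gen Wy * free_gen Wz) =
    g (free_gen Wz * W_word n 1 n * free_gen Wy) <->
  commute z (W_delta n X y).
Proof.
rewrite !gmulfM /= gmulf_W_word1 // gy gz -(mulgA z).
by split=> /esym.
Qed.

Hypothesis period : forall j, X (j + n) = y * X j * y^-1.
Hypothesis comm : commute z (W_delta n X y).

Let p := prefix_prod X.
Let delta := W_delta n X y.

Lemma gmulf_W_delta : g (W_word n 1 n * free_gen Wy) = delta.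
Proof. by rewrite gmulfM gmulf_W_word1 // gy. Qed.

(** The first word times [y] is p_i^-1 delta; this delta moves past [z] and turns delta^(q-1) into
    delta^q. *)
Lemma gmulf_W_lo i j : i <= n -> j <= n ->
  g (W_word n i.+1 n * free_gen Wy * free_gen Wz
     * expgz (W_word n 1 n * free_gen Wy) (q%:Z - 1)%R * W_word n 1 j)
  = (p i)^-1 * z * delta ^+ q * p j.
Proof.
move=> le_in le_jn; rewrite !gmulfM /= gmulf_W_word1 // gmulf_W_word ?le_in //=.
rewrite gy gz -(mulgA _ (p n)) -[p n * y]/delta; congr (_ * _).
have -> : g (expgz (W_word n 1 n * free_gen Wy) (q%:Z - 1)%R) = delta^-1 * delta ^+ q.
  (* For [q = 0] the exponent is -1 and [expgz] takes its [Negz] branch. *)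
  case: (q) => [|q']; first by rewrite /= gmulfV gmulf_W_delta mulg1.
  by rewrite intS GRing.addrC GRing.addKr /= gmulfXn /= gmulf_W_delta expgS mulKg.
have e : delta * z * (delta^-1 * delta ^+ q) = z * delta ^+ q.
  by rewrite -comm -(mulgA z) mulVKg.
by rewrite -!(mulgA (p i)^-1) -e.
Qed.

(** The delta coming from the first word is absorbed by the last prefix: delta p_j = p_(j+n) y. The
    trailing [y] is common to both sides of a relation and cancels. *)
Lemma gmulf_W_hi i j : i <= n -> j <= n ->
  g (W_word n i.+1 n * free_gen Wy * free_gen Wz
     * (W_word n 1 n * free_gen Wy) ^+ q * W_word n 1 j)
  = (p i)^-1 * z * delta ^+ q * p (j + n) * y.
Proof.
move=> le_in le_jn; rewrite !gmulfM /= gmulfXn /= gmulf_W_delta.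
rewrite gmulf_W_word1 // gmulf_W_word ?le_in //= gy gz.
have -> : p (j + n) = delta * p j * y^-1 by apply: prefix_prod_period.
have e : delta * z * delta ^+ q = z * delta ^+ q * delta.
  by rewrite -comm -!(mulgA z) -expgS -expgSr.
rewrite -(mulgA _ (p n)) -[p n * y]/delta; move: delta e => d e.
by rewrite !mulgA mulgVK -!(mulgA (p i)^-1) e.
Qed.

End WRelation.

Lemma W_relationP (H : groupType) (k b n c q r : nat) (X : nat -> H) (y z : H)
    (g : {groupmorph freegroup (W_generator n) -> H}) :
  0 < n -> r < n ->
  (forall i : 'I_n, g (free_gen (Wx i)) = X i) ->
  g (free_gen Wy) = y -> g (free_gen Wz) = z ->
  (forall j, X (j + n) = y * X j * y^-1) ->
  (forall u v, @W_relation k b n c q r u v -> g u = g v) <->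
  W_family k b n c q r X y z.
Proof.
move=> n_gt0 r_lt gx gy gz per; split=> [rel|fam u v].
  have comm : commute z (W_delta n X y).
    by apply/(W_rel_comm_iff gx gy gz)/rel; apply: W_rel_comm.
  apply: W_family_finite => // [j lt_jn|||j lt_jn].
  - have := rel _ _ (W_rel_x k b c q r (Ordinal lt_jn)).
    by rewrite gmulfXn /= gx gmulf1.
  - by have := rel _ _ (W_rel_y k b n c q r); rewrite gmulfXn /= gy gmulf1.
  - by have := rel _ _ (W_rel_z k b n c q r); rewrite gmulfXn /= gz gmulf1.
  (* The relation of index [i = j.+1] compares the twists at [j.+1] and [j]; it lies in the first
     long family exactly when [j + r < n]. *)
  - rewrite /W_twist addSn; have [lt_jr|le_nj] := ltnP (j + r) n.
      have lo : 1 <= j.+1 <= n - r by rewrite ltn_subRL addnC.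
      have := rel _ _ (W_rel_lo k b c q lo).
      by rewrite addSn subn1 /= !(gmulf_W_lo q gx gy gz) // ltnW.
    have hi : n - r + 1 <= j.+1 <= n by rewrite addn1 ltnS leq_subLR addnC le_nj.
    have := rel _ _ (W_rel_hi k b c q hi); rewrite addSn subSn // subn1 /=.
    have le_jr : (j + r - n).+1 <= n by lia.
    rewrite !(gmulf_W_hi q gx gy gz) // ?(ltnW lt_jn) // ?(ltnW le_jr) //.
    by rewrite addSn subnK // => /mulIg.
have [_ Xk yb zc comm tw] := fam.
have twist j : W_twist n q r X y z j.+1 = W_twist n q r X y z j.
  by rewrite !tw.
case=> [i||||i /andP[i_gt0 le_i]|i /andP[le_i le_in]].
- by rewrite gmulfXn /= gx gmulf1.
- by rewrite gmulfXn /= gy gmulf1.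
- by rewrite gmulfXn /= gz gmulf1.
- exact/(W_rel_comm_iff gx gy gz).
- case: i i_gt0 le_i => // j _ le_j; have le_jr : j.+1 + r <= n by lia.
  rewrite addSn subn1 /= !(gmulf_W_lo q gx gy gz) //; try lia.
  by rewrite -addSn; apply: twist.
- case: i le_i le_in => [|j] le_j lt_jn; first by lia.
  rewrite addSn subSn; last by lia.
  rewrite subn1 /= !(gmulf_W_hi q gx gy gz) //; try lia.
  by rewrite addSn subnK; last lia; rewrite -addSn; congr (_ * y); apply: twist.
Qed.

Lemma gmulf_W_twist (G H : groupType) (f : {groupmorph G -> H}) n q r X y z j :
  f (W_twist n q r X y z j) = W_twist n q r (f \o X) (f y) (f z) j.
Proof. by rewrite /W_twist /W_delta !gmulfM gmulfV gmulfXn gmulfM /= !gmulf_prod. Qed.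

(** * Dropping the first term of a family *)

Section Shift.
Variables (H : groupType) (n q r : nat) (X : nat -> H) (y z : H).
Local Notation X' := (fun j => X j.+1).
Hypothesis period : forall j, X (j + n) = y * X j * y^-1.

Lemma prefix_prod_shift j : prefix_prod X' j = (X 0)^-1 * prefix_prod X j.+1.
Proof. by rewrite prefix_prodSl mulKg. Qed.

(** The leading [X 0] is removed and reappears at the right end, because X_n y = y X_0. *)
Lemma W_delta_shift : W_delta n X' y = W_delta n X y ^ X 0.
Proof.
rewrite /W_delta prefix_prod_shift prefix_prodS (period 0 : X n = _) conjgE.
by rewrite !mulgA mulgVK.
Qed.

Lemma W_twist_shift j : W_twist n q r X' y (z ^ X 0) j = W_twist n q r X y z j.+1.
Proof.
rewrite /W_twist !prefix_prod_shift W_delta_shift -conjXg; move: (W_delta n X y) => d.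
by rewrite addSn !conjgE invgM invgK !mulgA !mulgK.
Qed.

End Shift.

(** Applied to the generators of the presented group itself, this is what makes the endomorphism
    [tau] well defined. *)
Lemma W_family_shift (H : groupType) (k b n c q r : nat) (X : nat -> H) (y z : H) :
  W_family k b n c q r X y z ->
  W_family k b n c q r (fun j => X j.+1) y (z ^ X 0).
Proof.
move=> [per Xk yb zc comm tw]; split=> // [j|||j].
- exact: (per j.+1).
- by rewrite -conjXg zc conj1g.
- by rewrite W_delta_shift // /commute -!conjMg comm.
- by rewrite !W_twist_shift // !tw.
Qed.

Lemma periodic_eq (H : groupType) n (X X' : nat -> H) y :
  0 < n -> (forall j, X (j + n) = y * X j * y^-1) ->
  (forall j, X' (j + n) = y * X' j * y^-1) ->
  (forall j, j < n -> X j = X' j) -> X =1 X'.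
Proof.
move=> n_gt0 per per' eqX; elim/ltn_ind=> j IHj.
have [/eqX //|le_nj] := ltnP j n.
by rewrite -(subnK le_nj) per per' IHj // ltn_subrL n_gt0 (leq_trans n_gt0).
Qed.

(** * The presented group and its automorphism [tau] *)

Section WPresented.
Variables (k b n c q r : nat).
Hypotheses (n_gt0 : 0 < n) (r_lt : r < n).
Local Notation P := (presented (@W_relation k b n c q r)).
Local Notation gen := (pres_gen (@W_relation k b n c q r)).

(** The index is split by division by [n]; the power of [y] is inverted because [a ^ h] means
    [h^-1 * a * h]. *)
Definition W_seq (j : nat) : P :=
  gen (Wx (Ordinal (ltn_pmod j n_gt0))) ^ (gen Wy ^- (j %/ n)).

Lemma W_seq_ord (i : 'I_n) : W_seq i = gen (Wx i).
Proof.
rewrite /W_seq divn_small // invg1 conjg1; congr (gen (Wx _)).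
by apply: val_inj; rewrite /= modn_small.
Qed.

Lemma W_seq_period j : W_seq (j + n) = gen Wy * W_seq j * (gen Wy)^-1.
Proof.
rewrite /W_seq divnDr // divnn n_gt0 addn1 expgS invgM.
have -> : Ordinal (ltn_pmod (j + n) n_gt0) = Ordinal (ltn_pmod j n_gt0).
  by apply: val_inj; rewrite /= modnDr.
by rewrite conjgM [in LHS]conjgE invgK mulgA.
Qed.

Lemma W_seq_family : W_family k b n c q r W_seq (gen Wy) (gen Wz).
Proof.
have [g [gE grel]] := presented_proj (@W_relation k b n c q r).
apply/(@W_relationP _ k b n c q r _ _ _ g) => //; last exact: W_seq_period.
by move=> i; rewrite gE W_seq_ord.
Qed.

Lemma W_presented_lift (H : groupType) (X : nat -> H) (y z : H) :
  W_family k b n c q r X y z ->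
  exists f : {groupmorph P -> H},
    [/\ forall j, f (W_seq j) = X j, f (gen Wy) = y & f (gen Wz) = z].
Proof.
move=> fam; pose phi (w : W_generator n) : H :=
  match w with Wx i => X i | Wy => y | Wz => z end.
have [g gphi|f fE] := @presented_lift _ (@W_relation k b n c q r) _ phi.
  apply/(@W_relationP _ k b n c q r X y z) => //.
  exact: W_family_period fam.
exists f; split; rewrite ?fE //.
apply: (periodic_eq n_gt0 (y := y)) => [j|j|j lt_jn].
- by rewrite W_seq_period; move: (W_seq j) => w; rewrite !gmulfM gmulfV /= fE.
- apply: (W_family_period fam).
- by rewrite (W_seq_ord (Ordinal lt_jn)) fE.
Qed.

Lemma W_presented_ext (H : groupType) (f g : P -> H) :
  {morph f : a b / a * b} -> {morph g : a b / a * b} ->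
  (forall j, f (W_seq j) = g (W_seq j)) -> f (gen Wy) = g (gen Wy) ->
  f (gen Wz) = g (gen Wz) -> f =1 g.
Proof.
move=> fM gM fgx fgy fgz; apply: presented_ext => // -[i||] //.
by rewrite -W_seq_ord.
Qed.

Local Notation C := (W_twist n q r W_seq (gen Wy) (gen Wz) 0).

Lemma W_automorphism : exists tau : P -> P,
  [/\ {morph tau : a b / a * b},
      forall j, tau (W_seq j) = W_seq j.+1 & tau (gen Wz) = gen Wz ^ W_seq 0] /\
  [/\ forall a, iter n tau a = gen Wy * a * (gen Wy)^-1,
      forall a, iter (b * n) tau a = a,
      tau C = C,
      tau (gen Wy) = gen Wy &
      forall a, C * iter r tau a = a * C].
Proof.
have fam := W_seq_family; have [per Xk yb zc comm tw] := fam.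
have [tau [tauX tauy tauz]] := W_presented_lift (W_family_shift fam).
have tauM i : {morph iter i tau : a b / a * b}.
  by elim: i => // i IHi a a'; rewrite /= IHi gmulfM.
have tauiX i j : iter i tau (W_seq j) = W_seq (j + i).
  by elim: i => [|i IHi]; rewrite ?addn0 // addnS /= IHi tauX.
have tauiy i : iter i tau (gen Wy) = gen Wy by elim: i => //= i ->.
(* Each further [tau] turns p_i into X_1 ... X_i and puts the missing X_0 in front. *)
have tauiz i : iter i tau (gen Wz) = gen Wz ^ prefix_prod W_seq i.
  elim: i => [|i IHi]; first by rewrite prefix_prod0 conjg1.
  rewrite /= IHi gmulfJ /= tauz gmulf_prod -conjgM prefix_prodSl.
  by under eq_bigr do rewrite tauX.
have conjyM : {morph (fun a => gen Wy * a * (gen Wy)^-1) : a b / a * b}.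
  by move=> a a'; rewrite !mulgA mulgVK.
have taun a : iter n tau a = gen Wy * a * (gen Wy)^-1.
  move: a; apply: W_presented_ext => //; rewrite ?mulgK //.
    by move=> j; rewrite tauiX per.
  (* On [z], write p_n = delta y^-1: conjugation by delta is trivial on [z], so only [y] remains. *)
  rewrite tauiz -[prefix_prod _ _](mulgK (gen Wy)).
  move: comm; rewrite /W_delta; move: (_ * gen Wy) => d zd.
  rewrite conjgM [_ ^ d]conjgE zd mulKg conjgE invgK mulgA.
  by [].
(* The image of the twist at 0 is the twist at 0 of the shifted family, that is, the original twist
   at 1. *)
have tauC : tau C = C.
  rewrite gmulf_W_twist tauy tauz -[RHS](tw 1%N) -W_twist_shift //.
  by congr (W_twist _ _ _ _ _ _ _); apply/funext => j; apply: tauX.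
exists tau; split; split=> //; first exact: gmulfM.
- move=> a; have iter_tau j : iter (j * n) tau a = gen Wy ^+ j * a * gen Wy ^- j.
    elim: j => [|j IHj]; first by rewrite invg1 mul1g mulg1.
    by rewrite mulSn iterD IHj taun expgS invgM !mulgA.
  by rewrite iter_tau yb invg1 mul1g mulg1.
(* Rewritten as C tau^r(a) C^-1 = a, the claim equates two morphisms, so generators suffice. *)
- move=> a; apply: (mulIg C^-1); rewrite mulgK; move: a; apply: W_presented_ext => //.
  + by move=> a a'; rewrite tauM; move: C => d; rewrite !mulgA mulgVK.
  + by move=> j; rewrite tauiX (W_family_twist_comm fam) mulgK.
  + by rewrite tauiy -(W_family_commute_y fam) mulgK.
  + rewrite tauiz; apply: (mulIg C); rewrite mulgVK.
    rewrite /W_twist prefix_prod0 invg1 mul1g add0n.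
    have := commute_z_deltaX comm q; move: (_ ^+ q) (prefix_prod _ r) => d p zd.
    by rewrite conjgE !mulgA mulgK -(mulgA _ d) -zd !mulgA.
Qed.

End WPresented.

(** * Semidirect products and subgroups generated by central elements *)

Record zmod_action (A : zmodType) (G : groupType) := ZmodAction {
  zmod_act :> A -> G -> G;
  zmod_act0 : forall x, zmod_act 0%R x = x;
  zmod_actD : forall a a' x, zmod_act (a + a')%R x = zmod_act a (zmod_act a' x);
  zmod_actM : forall a, {morph zmod_act a : x y / x * y} }.

Definition semidirect (A : zmodType) (G : groupType) (act : zmod_action A G) : Type :=
  (G * A)%type.

Section Semidirect.
Variables (A : zmodType) (G : groupType) (act : zmod_action A G).
Local Notation S := (semidirect act).

HB.instance Definition _ := Choice.on S.

Definition sd1 : S := (1, 0%R).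
Definition sdM (x y : S) : S := (x.1 * act x.2 y.1, (x.2 + y.2)%R).
Definition sdV (x : S) : S := (act (- x.2)%R x.1^-1, (- x.2)%R).

Lemma zmod_act1 a : act a 1 = 1.
Proof. by apply: (mulIg (act a 1)); rewrite -zmod_actM !mul1g. Qed.

Lemma sdMA : associative sdM.
Proof.
by move=> x y z; rewrite /sdM /= zmod_actD zmod_actM mulgA GRing.addrA.
Qed.

Lemma sd1M : left_id sd1 sdM.
Proof. by case=> x a; rewrite /sdM /= zmod_act0 mul1g GRing.add0r. Qed.

Lemma sdM1 : right_id sd1 sdM.
Proof. by case=> x a; rewrite /sdM /= zmod_act1 mulg1 GRing.addr0. Qed.

Lemma sdVM : left_inverse sd1 sdV sdM.
Proof.
by move=> x; rewrite /sdM /= -zmod_actM mulVg zmod_act1 GRing.addNr.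
Qed.

Lemma sdMV : right_inverse sd1 sdV sdM.
Proof.
by move=> x; rewrite /sdM /= -zmod_actD GRing.subrr zmod_act0 mulgV.
Qed.

HB.instance Definition _ := isGroup.Build S sdMA sd1M sdM1 sdVM sdMV.

Lemma sd_mulE (x y : S) : x * y = (x.1 * act x.2 y.1, (x.2 + y.2)%R).
Proof. by []. Qed.

Lemma sd_expg2 (x : S) j : (x ^+ j).2 = (x.2 *+ j)%R.
Proof. by elim: j => // j IHj; rewrite expgS GRing.mulrS -IHj. Qed.

Lemma sd_expg_inr a j : ((1, a) : S) ^+ j = (1, (a *+ j)%R).
Proof.
by elim: j => // j IHj; rewrite expgS IHj sd_mulE /= zmod_act1 mulg1 GRing.mulrS.
Qed.

End Semidirect.

(** As [w1] and [w2] are central, the quotients of monomials [w1 ^+ i * w2 ^+ j] already form a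
    normal subgroup; exponents on both sides replace negative powers. *)
Lemma normal_closure_central2 (G : groupType) (w1 w2 x : G) :
  (forall g, commute w1 g) -> (forall g, commute w2 g) ->
  normal_closure [set w1; w2]%classic x ->
  exists i j i' j', x * (w1 ^+ i * w2 ^+ j) = w1 ^+ i' * w2 ^+ j'.
Proof.
move=> c1 c2; pose w i j := w1 ^+ i * w2 ^+ j.
have wM i j i' j' : w i j * w i' j' = w (i + i')%N (j + j')%N.
  rewrite /w !expgnDr !mulgA; congr (_ * _); rewrite -!mulgA; congr (_ * _).
  exact/commute_sym/commuteX2/c1.
have wc i j g : commute g (w i j).
  by apply: commuteM; apply/commuteX/commute_sym.
have wJ i j g : w i j ^ g = w i j by rewrite conjgE -wc mulKg.
move=> /(_ [set g | exists i j i' j', g * w i j = w i' j']%classic); apply.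
split=> [|_ [->|->]] /=.
- split=> [|g h [i [j [i' [j' gw]]]] [i2 [j2 [i3 [j3 hw]]]]|g [i [j [i' [j' gw]]]]
    |g h [i [j [i' [j' gw]]]]].
  + by exists 0, 0, 0, 0; rewrite mul1g.
  + exists (i + i2)%N, (j + j2)%N, (i' + i3)%N, (j' + j3)%N.
    rewrite -!wM -(mulgA g) (mulgA h) (wc i j h) -(mulgA (w i j)) [h * _]hw.
    by rewrite mulgA [g * _]gw.
  + by exists i', j', i, j; rewrite -gw mulKg.
  + by exists i, j, i', j'; rewrite -(wJ i j h) -conjMg [g * _]gw wJ.
- by exists 0, 0, 1%N, 0; rewrite /w !expg0 !expg1 !mulg1.
- by exists 0, 0, 0, 1%N; rewrite /w !expg0 !expg1 mulg1 mul1g mulg1.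
Qed.

(** * Actions of ['Z_N] through an endomorphism whose [N]-th iterate is the identity *)

Section CyclicAction.
Variables (G : groupType) (tau : G -> G) (N : nat).
Hypotheses (N_gt1 : 1 < N) (tauM : {morph tau : x y / x * y})
  (tauN : forall x, iter N tau x = x).

Lemma iter_mod j x : iter (j %% N) tau x = iter j tau x.
Proof.
rewrite [in RHS](divn_eq j N) addnC iterD; congr (iter _ _ _).
by elim: (j %/ N) => // i IHi; rewrite mulSn iterD tauN.
Qed.

Lemma iter_actM j : {morph iter j tau : x y / x * y}.
Proof. by elim: j => // j IHj x y; rewrite /= IHj tauM. Qed.

(** The factor [B] acts trivially: it will carry the central element [D]. *)
Definition cyclic_act (B : zmodType) (a : 'Z_N * B) (x : G) := iter a.1 tau x.

Lemma cyclic_actD (B : zmodType) (a a' : 'Z_N * B) x :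
  cyclic_act (a + a')%R x = cyclic_act a (cyclic_act a' x).
Proof.
rewrite /cyclic_act -iterD /= -[RHS]iter_mod; congr (iter (_ %% _) _ _).
(* For [1 < N] the modulus built into ['Z_N] is [N] itself. *)
exact: Zp_cast.
Qed.

Definition cyclic_action (B : zmodType) : zmod_action ('Z_N * B)%type G :=
  @ZmodAction _ _ (@cyclic_act B) (fun _ => erefl) (@cyclic_actD B)
    (fun a => iter_actM a.1).

Lemma cyclic_action_nat (B : zmodType) j (a : B) x :
  cyclic_action B (j%:R%R, a) x = iter j tau x.
Proof. by rewrite /= /cyclic_act val_Zp_nat //= iter_mod. Qed.

End CyclicAction.

(** * Families of conjugates of [s] by powers of [t], and the relations of [J] *)

Section JFamily.
Variables (H : groupType) (k b n c m q r : nat) (s t : H).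
Hypothesis m_eq : m = q * n + r.

Local Notation X := (fun j => t ^+ j * s * t ^- j).

(** Telescoping: between consecutive letters [s] a single [t] survives. *)
Lemma prefix_prod_conj j : prefix_prod X j = (s * t) ^+ j * t ^- j.
Proof.
elim: j => [|j IHj]; first by rewrite prefix_prod0 invg1 mulg1.
by rewrite prefix_prodS IHj !mulgA mulgVK (expgSr (s * t)) (expgSr t) invgM !mulgA mulgK.
Qed.

Lemma W_delta_conj : W_delta n X (t ^+ n) = (s * t) ^+ n.
Proof. by rewrite /W_delta prefix_prod_conj mulgVK. Qed.

Lemma W_twist_conj z j : commute z (s * t) ->
  W_twist n q r X (t ^+ n) z j = t ^+ j * (z * (s * t) ^+ m) * t ^- (j + r).
Proof.
move=> zst; rewrite /W_twist W_delta_conj !prefix_prod_conj invgM invgK -expgnA.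
move: (s * t) zst => a za.
have e : a ^- j * (z * a ^+ (n * q) * a ^+ (j + r)) = z * a ^+ m.
  rewrite -mulgA -expgnDr; have -> : (n * q + (j + r) = j + m)%N by lia.
  by rewrite expgnDr (mulgA z) (commuteX j za) -mulgA mulKg.
by rewrite -e !mulgA.
Qed.

(** At index 0 the formula holds without commutation of [z] with [s * t]; [J_rel_of_W_family]
    deduces that commutation from it. *)
Lemma W_twist_conj0 z :
  W_twist n q r X (t ^+ n) z 0 = z * (s * t) ^+ m * t ^- r.
Proof.
rewrite /W_twist W_delta_conj prefix_prod0 invg1 mul1g prefix_prod_conj.
by rewrite add0n m_eq (mulnC q) expgnDr expgnA !mulgA.
Qed.

Lemma W_family_J u :
  0 < n -> s ^+ k = 1 -> t ^+ (b * n) = 1 -> u ^+ (c * m) = 1 ->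
  s * t * u = t * u * s -> t * u * s = u * s * t ->
  W_family k b n c q r X (t ^+ n) (u ^+ m).
Proof.
move=> n_gt0 sk tbn ucm stu tus.
have ust : commute u (s * t) by rewrite /commute mulgA stu tus.
have umst : commute (u ^+ m) (s * t) by apply/commute_sym/commuteX/commute_sym.
have tD : commute t (u * s * t) by rewrite /commute !mulgA tus.
split=> [j|j||||j].
- by rewrite addnC expgnDr invgM !mulgA.
- have -> : t ^+ j * s * t ^- j = s ^ t ^- j by rewrite conjgE invgK mulgA.
  by rewrite -conjXg sk conj1g.
- by rewrite -expgnA mulnC.
- by rewrite -expgnA mulnC.
- by rewrite W_delta_conj; apply: commuteX.
(* Here [u ^+ m * (s * t) ^+ m] is the [m]-th power of [u * s * t], which commutes with [t]; the
   powers [t ^+ j] and [t ^- j] then cancel. *)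
- rewrite !W_twist_conj // -expgMn // mulgA (commuteX2 j m tD) mul1g add0n.
  by rewrite (addnC j) expgnDr invgM !mulgA mulgK.
Qed.

(* [D] plays the role of the central element [stu], and [z] that of [u ^+ m]. *)
Lemma J_rel_of_W_family z D :
  let u := (s * t)^-1 * D in
  (forall g, commute D g) -> z ^+ c = 1 ->
  D ^+ m = W_twist n q r X (t ^+ n) z 0 * t ^+ r ->
  [/\ u ^+ m = z, u ^+ (c * m) = 1, s * t * u = t * u * s & t * u * s = u * s * t].
Proof.
move=> u cD zc; rewrite W_twist_conj0 mulgVK => Dm.
have zst : commute z (s * t).
  have -> : z = D ^+ m * (s * t) ^- m by rewrite Dm mulgK.
  apply/commute_sym/commuteM; first exact/commuteX/commute_sym/cD.
  exact/commuteV/commuteX.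
have um : u ^+ m = z.
  rewrite /u expgMn; last exact/commute_sym/cD.
  by rewrite Dm expVgn (commuteX m zst) mulKg.
have stu : s * t * u = D by rewrite mulVKg.
have tus : t * u * s = D.
  by rewrite /u invgM !mulgA mulgV mul1g -mulgA cD mulKg.
have ust : u * s * t = D by rewrite -mulgA /u -mulgA cD mulKg.
by rewrite mulnC expgnA um zc stu tus ust.
Qed.

End JFamily.

Lemma invg_expg (G : groupType) (g : G) N : 0 < N -> g ^+ N = 1 -> g^-1 = g ^+ N.-1.
Proof. by case: N => // N _; rewrite expgS => /mulg1_eq. Qed.

(** * The embedding of the presented group into [J] and the normality of its image *)

Section Embedding.
Variables (k b n c m q r : nat).
Hypotheses (n_gt0 : 0 < n) (bn_gt1 : 1 < b * n) (m_gt0 : 0 < m)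
  (m_eq : m = q * n + r) (r_lt : r < n).
Local Notation P := (presented (@W_relation k b n c q r)).
Local Notation x := (W_seq k b c q r n_gt0).
Local Notation y := (pres_gen (@W_relation k b n c q r) Wy).
Local Notation z := (pres_gen (@W_relation k b n c q r) Wz).
Local Notation C := (W_twist n q r x y z 0).

Lemma W_extension : exists (G : groupType) (e : {groupmorph P -> G}) (t D : G),
  [/\ forall j, e (x j) = t ^+ j * e (x 0) * t ^- j,
      e y = t ^+ n, t ^+ (b * n) = 1, forall g, commute D g & D ^+ m = e C * t ^+ r]
  /\ injective e.
Proof.
have fam := W_seq_family k b c q n_gt0 r_lt.
have [tau [[tauM taux tauz] [taun tauN tauC tauy tauCr]]] :=
  W_automorphism k b c q n_gt0 r_lt.
pose A := ('Z_(b * n) * int)%type.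
have [act act_nat act_fix] : exists2 act : zmod_action A P,
    forall i (a : int) g, act (i%:R%R, a) g = iter i tau g &
    forall a g, tau g = g -> act a g = g.
  exists (cyclic_action bn_gt1 tauM tauN int) => [i a g|a g tau_g].
    exact: cyclic_action_nat.
  by rewrite /= /cyclic_act; elim: (nat_of_ord a.1) => //= i ->.
pose S : groupType := semidirect act.
pose N i : A := (i%:R%R, 0%R).
pose e0 (a : P) : S := (a, 0%R).
pose t0 : S := (1, N 1%N).
pose D0 : S := (1, (0%R, 1%R)).
have act_yV a : act a y^-1 = y^-1.
  apply: (mulIg y); rewrite mulVg -[y in act a _ * y](act_fix a y tauy).
  by rewrite -zmod_actM mulVg zmod_act1.
(* [w1] is y^-1 t^n and [w2] is C t^r D^-m; killing them imposes the relations required of [e y] and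
   [D ^+ m]. *)
pose w1 : S := (y^-1, N n).
pose w2 : S := (C, (r%:R%R, - m%:Z)%R).
have w1_central (g : S) : commute w1 g.
  rewrite /commute !sd_mulE /= act_nat act_yV taun !mulgA mulVg mul1g.
  by rewrite GRing.addrC.
have w2_central (g : S) : commute w2 g.
  by rewrite /commute !sd_mulE /= act_nat (act_fix _ C) // tauCr GRing.addrC.
have D0_central (g : S) : commute D0 g.
  by rewrite /commute !sd_mulE /= (act_nat 0) zmod_act1 mul1g mulg1 GRing.addrC.
have e0M : {morph e0 : g h / g * h}.
  by move=> g h; rewrite sd_mulE /= zmod_act0 GRing.addr0.
have [e0' e0E] := groupmorph_exists e0M.
have pairMn (a : 'Z_(b * n)) (a' : int) i : ((a, a') *+ i = (a *+ i, a' *+ i))%R.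
  by elim: i => // i IHi; rewrite !GRing.mulrS IHi.
have t0X i : t0 ^+ i = (1, N i).
  by rewrite /t0 sd_expg_inr pairMn GRing.mul0rn.
have D0X i : D0 ^+ i = (1, (0%R, Posz i)).
  by rewrite /D0 sd_expg_inr pairMn GRing.mul0rn natz.
have act0N (a : A) : act a 1 = 1 by apply: zmod_act1.
have tau_x j : iter j tau (x 0) = x j by elim: j => //= j ->.
have t0_x j : t0 ^+ j * e0 (x 0) = e0 (x j) * t0 ^+ j.
  by rewrite t0X !sd_mulE /= act_nat act0N tau_x mulg1 mul1g GRing.addr0 GRing.add0r.
have w1E : e0 y * w1 = t0 ^+ n.
  by rewrite t0X sd_mulE /= (act_nat 0) mulgV GRing.add0r.
have w2E : w2 * D0 ^+ m = e0 C * t0 ^+ r.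
  rewrite t0X D0X !sd_mulE /= !act0N mulg1 GRing.add0r; congr (_, _).
  by congr (_, _); rewrite /= ?GRing.addr0 ?GRing.addNr.
have t0N : t0 ^+ (b * n) = 1.
  rewrite t0X; congr (_, (_, _)); apply: val_inj; by rewrite /= val_Zp_nat // modnn.
pose E : groupType := ncl_quotient [set w1; w2]%classic.
pose pr : {groupmorph S -> E} := ncl_proj [set w1; w2]%classic.
have pr_surj (g : E) : exists h, g = pr h.
  by exists (repr g); rewrite /= /ncl_proj reprK.
have pr_w1 : pr w1 = 1 by apply: ncl_proj_rel; left.
have pr_w2 : pr w2 = 1 by apply: ncl_proj_rel; right.
pose e : {groupmorph P -> E} := pr \o e0'.
have eE a : e a = pr (e0 a) by rewrite /= e0E.
exists E, e, (pr t0), (pr D0); split; first split.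
- move=> j; rewrite !eE; apply: (mulIg (pr t0 ^+ j)).
  by rewrite mulgVK -gmulfXn -[LHS]gmulfM -[RHS]gmulfM t0_x.
- by rewrite eE -gmulfXn -w1E gmulfM [pr w1]pr_w1 mulg1.
- by rewrite -gmulfXn t0N gmulf1.
- by move=> g; have [h ->] := pr_surj g; apply: gmulf_commute.
- by rewrite -!gmulfXn eE -[RHS]gmulfM -w2E gmulfM [pr w2]pr_w2 mul1g.
apply: gmulf_inj => a; rewrite eE => /ncl_proj_eq1 ea.
have [i [j [i' [j' eq_w]]]] := normal_closure_central2 w1_central w2_central ea.
have eq2 i1 j1 : (w1 ^+ i1 * w2 ^+ j1).2 = ((n * i1 + r * j1)%:R%R, (- Posz (m * j1))%R).
  rewrite sd_mulE /= !sd_expg2 !pairMn GRing.mul0rn GRing.mulNrn; congr (_, _).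
    by rewrite GRing.natrD !GRing.natrM !GRing.mulr_natr.
  by rewrite /= GRing.add0r; congr (- _)%R; rewrite -GRing.mulr_natr natz PoszM.
have snd_e0 g : (e0 a * g).2 = g.2 by rewrite sd_mulE /= GRing.add0r.
(* The exponents of [D0] are -mj and -mj', with [m] positive. *)
have eq_jj' : j = j'.
  have := congr1 (fun g : S => g.2) eq_w.
  by rewrite snd_e0 !eq2 => /(congr1 snd) /= /GRing.oppr_inj[] /eqP;
    rewrite eqn_pmul2l // => /eqP.
move: eq_w; rewrite -eq_jj' mulgA => /mulIg eq_w.
(* Once [w2] is cancelled, the exponents [n * i] and [n * i'] of [t0] agree modulo [b * n]. *)
have eq_ii' : i = i' %[mod b].
  have := congr1 (fun g : S => g.2) eq_w.
  rewrite snd_e0 !sd_expg2 !pairMn /= -!GRing.mulrnA => /(congr1 fst) /(congr1 val).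
  by rewrite /= !val_Zp_nat // (mulnC b) -!muln_modr => /eqP;
    rewrite eqn_pmul2l // => /eqP.
(* [w1] is central and [e0 y * w1 = t0 ^+ n], so this follows from y^b = 1 and the order of [t0]. *)
have w1b : w1 ^+ b = 1.
  have [_ _ yb _ _ _] := fam.
  have : (e0 y * w1) ^+ b = 1 by rewrite w1E -expgnA mulnC.
  rewrite expgMn; last exact/commute_sym/w1_central.
  by rewrite -e0E -gmulfXn yb gmulf1 mul1g.
move: eq_w; rewrite (divn_eq i b) (divn_eq i' b) eq_ii' !expgnDr !(mulnC _ b).
rewrite !expgnA w1b !expg1n.
by rewrite !mul1g -{2}[w1 ^+ _]mul1g => /mulIg[].
Qed.

Local Notation J := (J k (b * n) (c * m)).
Local Notation s := (J_s k (b * n) (c * m)).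
Local Notation t := (J_t k (b * n) (c * m)).
Local Notation u := (J_u k (b * n) (c * m)).

Lemma J_relations :
  [/\ s ^+ k = 1, t ^+ (b * n) = 1, u ^+ (c * m) = 1,
      s * t * u = t * u * s & t * u * s = u * s * t].
Proof.
have [g [gE grel]] := presented_proj (@J_relation k (b * n) (c * m)).
by split; [have := grel _ _ (J_rel_s _ _ _) | have := grel _ _ (J_rel_t _ _ _)
  | have := grel _ _ (J_rel_u _ _ _) | have := grel _ _ (J_rel_stu_tus _ _ _)
  | have := grel _ _ (J_rel_tus_ust _ _ _)];
  rewrite ?gmulf1 ?gmulfXn ?gmulfM /= ?gE.
Qed.

Lemma W_presented_to_J :
  exists g : {groupmorph P -> J},
    [/\ injective g, forall j, g (x j) = t ^+ j * s * t ^- j,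
        g y = t ^+ n & g z = u ^+ m].
Proof.
have [sk tbn ucm stu tus] := J_relations.
have famJ := W_family_J m_eq n_gt0 sk tbn ucm stu tus.
have [g [gx gy gz]] := W_presented_lift n_gt0 r_lt famJ.
exists g; split=> // a a'.
have [G [e [t' [D [[ex ey t'bn cD Dm] e_inj]]]]] := W_extension.
have [_ xk _ zc _ _] := W_seq_family k b c q n_gt0 r_lt.
have [||u'm u'cm stu' tus'] :=
    J_rel_of_W_family (c := c) (s := e (x 0)) (t := t') (z := e z) m_eq cD.
- by rewrite -gmulfXn zc gmulf1.
- rewrite Dm gmulf_W_twist ey; congr (W_twist _ _ _ _ _ _ _ * _).
  by apply/funext => j; apply: ex.
(* The value at [Ju] is forced by the requirement that [D] be the image of [s * t * u]. *)
pose phi (l : J_generator) : G :=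
  match l with Js => e (x 0) | Jt => t' | Ju => (e (x 0) * t')^-1 * D end.
have [h' h'phi|h hphi] := @presented_lift _ (@J_relation k (b * n) (c * m)) _ phi.
  by move=> _ _ []; rewrite ?gmulf1 ?gmulfXn ?gmulfM /= ?h'phi //= -?gmulfXn ?xk ?gmulf1.
have [hs ht] : h s = e (x 0) /\ h t = t' by rewrite !hphi.
(* The injective map [e] factors through [g], so [g] is injective. *)
have hg : h \o g =1 e.
  apply: W_presented_ext => //.
  - by move=> v w; rewrite /= !gmulfM.
  - exact: gmulfM.
  - move=> j; rewrite ex /= gx; move: (e (x 0)) hs => e0 hs.
    by rewrite !gmulfM gmulfV !gmulfXn /= hs ht.
  - by rewrite /= gy gmulfXn /= hphi.
  - by rewrite /= gz gmulfXn /= hphi.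
by move=> gaa'; apply: e_inj; rewrite -!hg /= gaa'.
Qed.

(** The relations identify the three cyclic rotations of [s * t * u], so it commutes with each
    generator. *)
Lemma J_stu_central h : commute h (s * t * u).
Proof.
have [_ _ _ stu tus] := J_relations.
have comm_s : commute (s * t * u) s by rewrite /commute [in RHS]stu !mulgA.
have comm_t : commute (s * t * u) t by rewrite /commute stu tus !mulgA tus.
have comm_u : commute (s * t * u) u by rewrite /commute !mulgA -tus -stu.
have gen_comm l : commute (s * t * u) (pres_gen (@J_relation k (b * n) (c * m)) l).
  by case: l.
elim/presented_ind: h => [|l h IHh|l h IHh]; apply/commute_sym.
- exact: commute1.
- by apply: commuteM => //; apply/commute_sym.
- by apply: commuteM; [apply: commuteV|apply/commute_sym].
Qed.

Lemma W_image_normal (g : {groupmorph P -> J}) :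
  0 < c -> (forall j, g (x j) = t ^+ j * s * t ^- j) ->
  g y = t ^+ n -> g z = u ^+ m ->
  forall a h, exists a', g a ^ h = g a'.
Proof.
move=> c_gt0 gx gy gz.
have [sk tbn ucm stu tus] := J_relations.
have [tau [[tauM taux tauz] [_ _ _ tauy _]]] := W_automorphism k b c q n_gt0 r_lt.
(* This is one inclusion only and does not pass to [h^-1] by itself: [s^-1] is handled as an element
   of the image, [t] and [u^-1] as powers of [t^-1] and [u]. *)
pose norm h := forall a, exists a', g a ^ h = g a'.
have normM h h' : norm h -> norm h' -> norm (h * h').
  by move=> nh nh' a; rewrite conjgM; have [a1 ->] := nh a; apply: nh'.
have normX h i : norm h -> norm (h ^+ i).
  move=> nh; elim: i => [a|i IHi]; first by exists a; rewrite conjg1.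
  by rewrite expgS; apply: normM.
have norm_g a : norm (g a) by move=> a'; exists (a' ^ a); rewrite gmulfJ.
have gs : g (x 0) = s by rewrite gx mul1g invg1 mulg1.
have norm_s : norm s by rewrite -gs.
have norm_sV : norm s^-1 by rewrite -gs -gmulfV.
(* Conjugation by [t^-1], which sends a to t a t^-1, restricts to [tau] on the image. *)
have norm_tV : norm t^-1.
  move=> a; exists (tau a); move: a; apply: W_presented_ext.
  - by move=> a a'; rewrite gmulfM conjMg.
  - by move=> a a'; rewrite tauM gmulfM.
  - by move=> j; rewrite taux !gx conjgE invgK expgS invgM !mulgA.
  - by rewrite tauy gy conjgE invgK mulgA -expgS expgSr mulgK.
  - rewrite tauz gmulfJ /= gs gz conjgE invgK; apply: (mulgI s).
    (* This commutation gives t u^m t^-1 = s^-1 u^m s, the image of [tau z]. *)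
    have ust : commute (u ^+ m) (s * t).
      by apply/commute_sym/commuteX; rewrite /commute stu tus mulgA.
    by rewrite conjgE mulVKg mulgA mulgA -ust mulgA mulgK.
have norm_t : norm t.
  rewrite -[t]invgK (@invg_expg _ _ (b * n)); first exact: normX.
    exact: ltnW.
  by rewrite expVgn tbn invg1.
(* [u] is the product of (st)^-1 and the central element [s * t * u], which conjugates trivially. *)
have norm_u : norm u.
  have -> : u = t^-1 * s^-1 * (s * t * u) by rewrite !mulgA mulgVK mulVg mul1g.
  apply: (normM _ _ (normM _ _ norm_tV norm_sV)).
  by move=> a; exists a; rewrite conjgE J_stu_central mulKg.
have norm_uV : norm u^-1.
  by rewrite (@invg_expg _ _ (c * m)) ?muln_gt0 ?c_gt0 //; apply: normX.
move=> a h; move: h a; apply: presented_ind => [a|l h nh|l h nh].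
- by exists a; rewrite conjg1.
- by apply: normM nh; case: l.
- by apply: normM nh; case: l.
Qed.

End Embedding.

(** * Identification of the image with the normal closure *)

Theorem theorem2p29 (k b n c m q r : nat)
    (k_gt1 : 1 < k)
    (b_gt0 : 0 < b) (n_gt0 : 0 < n) (bn_gt1 : 1 < b * n)
    (c_gt0 : 0 < c) (m_gt0 : 0 < m) (cm_gt1 : 1 < c * m)
    (coprime_nm : coprime n m)
    (m_eq : m = q * n + r) (r_lt : r < n) :
  exists f : {multiplicative presented (@W_relation k b n c q r) -> W k b n c m},
    let s := J_s k (b * n) (c * m) in
    let t := J_t k (b * n) (c * m) in
    let u := J_u k (b * n) (c * m) in
    [/\ bijective f,
        forall i : 'I_n,
          \val (f (pres_gen (@W_relation k b n c q r) (Wx i)))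
            = t ^+ i * s * t ^- i,
        \val (f (pres_gen (@W_relation k b n c q r) Wy)) = t ^+ n
      & \val (f (pres_gen (@W_relation k b n c q r) Wz)) = u ^+ m].
Proof.
have [g [g_inj gx gy gz]] := W_presented_to_J k c n_gt0 bn_gt1 m_gt0 m_eq r_lt.
set s := J_s k (b * n) (c * m) in gx *; set t := J_t k (b * n) (c * m) in gx gy *;
  set u := J_u k (b * n) (c * m) in gz *.
set A := [set J_s k (b * n) (c * m); J_t k (b * n) (c * m) ^+ n;
  J_u k (b * n) (c * m) ^+ m]%classic.
have [N1 NM NV NJ] := normal_closureP A.
have NA h : A h -> normal_closure A h by move=> Ah S [_]; apply.
have gA a : normal_closure A (g a).
  have gen_g l : normal_closure A (g (pres_gen (@W_relation k b n c q r) l)).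
    case: l => [i||]; last by rewrite gz; apply: NA; right.
      rewrite -(W_seq_ord _ _ _ _ _ n_gt0) gx.
      have -> : t ^+ i * s * t ^- i = s ^ t ^- i by rewrite conjgE invgK mulgA.
      by apply: NJ; apply: NA; left; left.
    by rewrite gy; apply: NA; left; right.
  elim/presented_ind: a => [|l a IHa|l a IHa]; rewrite ?gmulf1 // gmulfM ?gmulfV.
  - exact: NM (gen_g l) IHa.
  - exact: NM (NV _ (gen_g l)) IHa.
have gA' a : g a \in normal_closure A by rewrite inE.
pose f0 a : W k b n c m := Sub (g a) (gA' a).
have f0M : {morph f0 : a a' / a * a'}.
  by move=> a a'; apply: val_inj; rewrite valM !SubK gmulfM.
have [f fE] := groupmorph_exists f0M.
have valf a : \val (f a) = g a by rewrite fE SubK.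
have f_surj w : exists a, f a = w.
  have : normal_closure A (val w) by have := valP w; rewrite inE.
  (* The image of [g] is a normal subgroup containing [A], so minimality of the normal closure gives
     surjectivity. *)
  move=> /(_ [set h | exists a, g a = h]%classic) [|a ga]; last first.
    by exists a; apply: val_inj; rewrite valf.
  split; last first.
    move=> _ [[->|->]|->] /=; last by exists (pres_gen _ Wz).
      by exists (W_seq k b c q r n_gt0 0); rewrite gx mul1g invg1 mulg1.
    by exists (pres_gen _ Wy).
  split=> [|_ _ [a <-] [a' <-]|_ [a <-]|_ h [a <-]] /=.
  - by exists 1; rewrite gmulf1.
  - by exists (a * a'); rewrite gmulfM.
  - by exists a^-1; rewrite gmulfV.
  - have [a' ->] := W_image_normal bn_gt1 m_gt0 r_lt c_gt0 gx gy gz a h.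
    by exists a'.
have [finv finvK] := choice f_surj.
exists f; split.
- exists finv => // a; apply: g_inj; rewrite -!valf finvK //.
- by move=> i; rewrite valf -(W_seq_ord _ _ _ _ _ n_gt0) gx.
- by rewrite valf.
- by rewrite valf.
Qed.
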